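(* Let $F$ be a Ferrers board and let $\tau \in \{231, 312\}$. Then a placement $P \in S_F(\tau)$ is determined by $F$ and the sequence $S(P,F)$; that is, if $P, Q \in S_F(\tau)$ and $S(P,F) = S(Q,F)$, then $P = Q$.
   Context: Let $\mathcal{A}$ be an $m\times m$ array of unit squares in the $xy$-plane with its bottom left corner at the origin. The corners of squares are called vertices. For a vertex $V=(a,b)$, $R(V)$ denotes the rectangular array of squares bounded by the lines $x=0$, $x=a$, $y=0$, $y=b$ (empty if $a=0$ or $b=0$). A Ferrers board is a subset $F$ of $\mathcal{A}$ (for some $m$) such that $R(V)\subseteq F$ for each vertex $V$ of $F$ (a vertex of $F$ is a corner of a square of $F$). So $F$ is left- and bottom-justified. The right/up border of $F$ is the border of $F$ excluding the vertical left-hand side and the horizontal bottom side: it is the lattice path of unit rightward and downward steps along the boundary of $F$ from the top left corner $(0,h)$ of $F$ to the bottom right corner $(w,0)$, where $h$ is the length of the longest column and $w$ that of the longest row; both endpoints are vertices of the right/up border. A rook placement on $F$ is a subset of the squares of $F$ (the squares containing ''markers'') with at most one square in each row and at most one in each column of $F$; a full rook placement has exactly one marker in each row and each column of $F$. A rook placement $P$ on $F$ avoids a pattern $\tau$ if for every vertex $V$ on the right/up border of $F$ the permutation order-isomorphic to the restriction of $P$ to $R(V)$ (markers read left to right, by height) avoids $\tau$ in the usual sense (has no subsequence order-isomorphic to $\tau$). $S_F(\tau)$ is the set of all full rook placements on $F$ that avoid $\tau$. For a rook placement $P$ on $F$ and a vertex $V$ of $F$, $S(P,V)$ is the maximal length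 of an increasing sequence of markers of $P$ in $R(V)$ (each successive marker strictly to the right of and strictly above the previous one); it is $0$ if $R(V)$ contains no marker. For a full rook placement $P$, $S(P,F)$ denotes the sequence of values $S(P,V)$ for all vertices $V$ on the right/up border of $F$, in order, starting with the top left corner of $F$. *)

(* Defs.v *)
From mathcomp Require Import all_boot.

Set Implicit Arguments.
Unset Strict Implicit.
Unset Printing Implicit Defensive.

(* The square [(i, j)] has lower left corner [(i, j)]: [i] is its column,
   counted from the left, and [j] is its row, counted from the bottom. *)
Definition square (m : nat) : finType := ('I_m * 'I_m)%type.

Definition point : Type := (nat * nat)%type.

Definition corner m (s : square m) (V : point) : bool :=
  ((V.1 == s.1) || (V.1 == s.1.+1)) && ((V.2 == s.2) || (V.2 == s.2.+1)).

Definition vertex m (F : {set square m}) (V : point) : bool :=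
  [exists s in F, corner s V].

Definition rect m (V : point) : {set square m} :=
  [set s : square m | (s.1 < V.1) && (s.2 < V.2)].

Definition ferrers m (F : {set square m}) : Prop :=
  forall V : point, vertex F V -> rect m V \subset F.

Definition col m (A : {set square m}) (i : 'I_m) : {set square m} :=
  [set s in A | s.1 == i].

Definition row m (A : {set square m}) (j : 'I_m) : {set square m} :=
  [set s in A | s.2 == j].

Definition height m (F : {set square m}) : nat := \max_(i < m) #|col F i|.
Definition width m (F : {set square m}) : nat := \max_(j < m) #|row F j|.

(* One unit step of the right/up border.  From a vertex of the border the path
   goes right when the square whose top left corner is that vertex belongs to
   [F] (along the top side of that square), and down otherwise. *)
Definition border_step m (F : {set square m}) (V : point) : point :=
  if [exists s in F, (s.1 == V.1 :> nat) && (s.2.+1 == V.2)]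
  then (V.1.+1, V.2) else (V.1, V.2.-1).

(* The vertices of the path from [(0, height F)] to [(width F, 0)], in order;
   the path has [width F] right steps and [height F] down steps. For empty [F]
   it degenerates to the origin. *)
Definition border m (F : {set square m}) : seq point :=
  traject (border_step F) (0, height F) (width F + height F).+1.

Definition rook_placement m (F P : {set square m}) : Prop :=
  [/\ P \subset F,
      forall i : 'I_m, #|col P i| <= 1
    & forall j : 'I_m, #|row P j| <= 1].

(* The columns (resp. rows) of [F] are the nonempty ones. *)
Definition full_rook_placement m (F P : {set square m}) : Prop :=
  [/\ rook_placement F P,
      forall i : 'I_m, col F i != set0 -> #|col P i| = 1
    & forall j : 'I_m, row F j != set0 -> #|row P j| = 1].

Definition heights m (A : {set square m}) : seq nat :=
  [seq nat_of_ord s.2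
     | s <- [seq (i, j) | i <- enum 'I_m, j <- enum 'I_m] & s \in A].

(* For a word with distinct letters, the permutation of [1, ..., size w]
   order-isomorphic to it, in one-line notation. *)
Definition standardize (w : seq nat) : seq nat :=
  [seq count (fun y => y <= x) w | x <- w].

Definition order_isomorphic (u v : seq nat) : Prop :=
  size u = size v /\
  forall i j, i < size u -> j < size u ->
    (nth 0 u i < nth 0 u j) = (nth 0 v i < nth 0 v j).

Definition avoids (w tau : seq nat) : Prop :=
  ~ exists2 u, subseq u w & order_isomorphic u tau.

Definition placement_avoids m (F P : {set square m}) (tau : seq nat) : Prop :=
  forall V, V \in border F -> avoids (standardize (heights (P :&: rect m V))) tau.

(* [P] belongs to S_F(tau). *)
Definition full_avoider m (F : {set square m}) (tau : seq nat)
    (P : {set square m}) : Prop :=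
  full_rook_placement F P /\ placement_avoids F P tau.

Definition above_right m (s t : square m) : bool := (s.1 < t.1) && (s.2 < t.2).

(* S(P, V).  An increasing sequence of squares has distinct columns, so its
   length is at most [m] and the bound on [k] loses nothing. *)
Definition max_increasing m (P : {set square m}) (V : point) : nat :=
  \max_(k < m.+1 | [exists t : k.-tuple (square m),
                      all (mem (P :&: rect m V)) t && sorted (@above_right m) t])
    k.

(* S(P, F). *)
Definition border_values m (P F : {set square m}) : seq nat :=
  [seq max_increasing P V | V <- border F].

(* Main.v *)
(* For 231-avoiders, follow the longest increasing sequence of [R(a, b)] as the
   top row is removed: it drops exactly when the marker of the removed row is
   the rightmost one. Let [runs P a b] list, from the top, the numbers of
   occupied rows between consecutive drops, and read the border backwards from
   its lower right end. Crossing a down step adds 1 to the first run or opens a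
   new one, and the border values tell which. For a right step adding a marker
   [s] in column [a], the first run of [R(a+1, b)] is [j + 1], where [j] is the
   number of markers of [R(a, b)] above [s], and the runs of [R(a, b)] are those
   of [R(a+1, b)] with the first run either decreased by 1 or replaced by adding
   [j] to the next one, according to whether the border value stays or changes.
   Hence the border values determine all [runs] along the border, and so the
   number [j] for each column; these numbers determine the placement column by
   column from the right. The pattern 312 reduces to 231 by reflection in the
   diagonal. *)
Require Import Defs.
From mathcomp Require Import all_boot zify.

Set Implicit Arguments.
Unset Strict Implicit.
Unset Printing Implicit Defensive.

(* [simpl] identifies ['I_m] with its [Finite.sort] form inside [square m];
   [lia] would see the two as different atoms. *)
Ltac slia := simpl in *; lia.

(** * Longest increasing sequences of markers in a rectangle *)

Section Chains.
Variables (m : nat) (P : {set square m}).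
Implicit Types (s t u : square m) (c : seq (square m)) (a b : nat).

Definition chain a b c :=
  all (mem (P :&: rect m (a, b))) c && sorted (@above_right m) c.

Lemma above_right_trans : transitive (@above_right m).
Proof. by move=> t s u; rewrite /above_right; slia. Qed.

(** By transitivity a sorted list is pairwise sorted, so the markers before [s] are those of a chain
    in the rectangle below and to the left of [s]. This lets arguments on chains peel off the last
    marker. *)
Lemma chain_rcons a b c s :
  chain a b (rcons c s) =
    [&& s \in P, s.1 < a, s.2 < b & chain s.1 s.2 c].
Proof.
rewrite /chain all_rcons !(sorted_pairwise above_right_trans) pairwise_rcons.
rewrite [mem _ s]inE !inE /= -!andbA.
have [sP|] //= := boolP (s \in P); have [sa|] //= := ltnP s.1 a.
have [sb|] //= := ltnP s.2 b.
rewrite !andbA; congr (_ && _); rewrite -all_predI; apply: eq_all => t /=.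
rewrite !inE /= /above_right; case: (t \in P) => //=; apply/andP/andP => [[_ /andP[]]|[]] //. slia.
Qed.

Lemma chain_size a b c : chain a b c -> size c <= a.
Proof.
elim/last_ind: c a b => [|c s IH] a b //; rewrite chain_rcons size_rcons.
by case/and4P=> _ sa _ /IH; slia.
Qed.

Lemma chain_leq a b a' b' c :
  a <= a' -> b <= b' -> chain a b c -> chain a' b' c.
Proof.
case/lastP: c => [|c s] // ha hb; rewrite !chain_rcons => /and4P[-> ? ? ->].
by rewrite andbT; slia.
Qed.

Lemma chain_max_increasing a b c :
  chain a b c -> size c <= max_increasing P (a, b).
Proof.
move=> hc; have hm : size c < m.+1.
  case/lastP: c hc => [|c s] //; rewrite chain_rcons size_rcons.
  by case/and4P=> _ _ _ /chain_size h; have := ltn_ord s.1; slia.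
rewrite /max_increasing.
apply: (@bigmax_sup _ (Ordinal hm)) => //.
by apply/existsP; exists (in_tuple c).
Qed.

Lemma max_increasing_chain a b :
  exists2 c, chain a b c & size c = max_increasing P (a, b).
Proof.
rewrite /max_increasing (@bigmax_eq_arg _ ord0); last first.
  by apply/existsP; exists [tuple].
case: arg_maxnP => [|k /existsP[t ht] _]; first by apply/existsP; exists [tuple].
by exists t => //; rewrite size_tuple.
Qed.

Lemma max_increasing_leq a b a' b' : a <= a' -> b <= b' ->
  max_increasing P (a, b) <= max_increasing P (a', b').
Proof.
move=> ha hb; have [c hc <-] := max_increasing_chain a b.
by apply: chain_max_increasing; apply: chain_leq hc.
Qed.

Lemma max_increasing0 a : max_increasing P (a, 0) = 0.
Proof.
have [c + <-] := max_increasing_chain a 0.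
by case/lastP: c => [|c s] //; rewrite chain_rcons ltn0 !andbF.
Qed.

Lemma max_increasingS a b :
  max_increasing P (a, b.+1) <= (max_increasing P (a, b)).+1.
Proof.
have [c + <-] := max_increasing_chain a b.+1.
case/lastP: c => [|c s] //; rewrite chain_rcons size_rcons ltnS.
case/and4P=> _ sa sb hc; apply: chain_max_increasing.
by apply: chain_leq hc; slia.
Qed.

(** * Effect of one row on the longest increasing sequence *)

Definition has_row a b := [exists s in P, (s.1 < a) && (s.2 == b :> nat)].

Lemma has_rowP a b :
  reflect (exists s, [/\ s \in P, s.1 < a & s.2 = b :> nat]) (has_row a b).
Proof.
apply: (iffP exists_inP) => [[s sP /andP[sa /eqP sb]]|[s [sP sa sb]]].
  by exists s.
by exists s; rewrite ?sa ?sb /=.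
Qed.

(** The marker of row [b] is not the rightmost one of R(a, b+1), so that for a 231-avoider removing
    the row causes no drop. *)
Definition row_tail a b :=
  [exists s in P, exists t in P,
    [&& s.2 == b :> nat, s.1 < t.1, t.1 < a & t.2 < b]].

Lemma row_tailP a b :
  reflect (exists s t, [/\ s \in P, t \in P, s.2 = b :> nat,
             s.1 < t.1 < a & t.2 < b])
          (row_tail a b).
Proof.
apply: (iffP exists_inP) => [[s sP /exists_inP[t tP]]|].
  by case/and4P=> /eqP ? ? ? ?; exists s, t; split=> //; apply/andP.
case=> s [t [sP tP sb /andP[st ta] tb]]; exists s => //; apply/exists_inP.
by exists t => //; apply/and4P; split=> //; apply/eqP.
Qed.

Hypothesis colP : {in P &, injective (fun s => s.1)}.
Hypothesis rowP : {in P &, injective (fun s => s.2)}.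

(** In an occurrence of 231, [u] is the rightmost marker and [t] the highest, so the last two bounds
    place all three in R(a, b). *)
Definition avoids231 a b := forall s t u,
  s \in P -> t \in P -> u \in P -> s.1 < t.1 < u.1 -> u.2 < s.2 < t.2 ->
  u.1 < a -> t.2 < b -> False.

Lemma avoids231_leq a b a' b' :
  a' <= a -> b' <= b -> avoids231 a b -> avoids231 a' b'.
Proof.
move=> ha hb h s t u sP tP uP h1 h2 ua tb.
by apply: (h s t u) => //; [exact: leq_trans ha | exact: leq_trans hb].
Qed.

Lemma max_increasing_empty_row a b : ~~ has_row a b ->
  max_increasing P (a, b.+1) = max_increasing P (a, b).
Proof.
move=> /has_rowP hN; apply/eqP; rewrite eqn_leq (max_increasing_leq (leqnn a) (leqnSn b)) andbT.
have [c + <-] := max_increasing_chain a b.+1.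
case/lastP: c => [|c s] // hc; apply: chain_max_increasing; move: hc.
rewrite !chain_rcons => /and4P[sP sa sb ->]; rewrite sP sa andbT /=.
case: (ltngtP s.2 b) => // [|sb']; first by slia.
by case: hN; exists s.
Qed.

(** The marker of row [b] is above and to the right of all markers of R(a, b), so it extends a
    longest chain there. *)
Lemma max_increasing_row_last a b : has_row a b -> ~~ row_tail a b ->
  max_increasing P (a, b.+1) = (max_increasing P (a, b)).+1.
Proof.
case/has_rowP=> s [sP sa sb] /row_tailP hN.
apply/eqP; rewrite eqn_leq max_increasingS /=.
have [c hc <-] := max_increasing_chain a b.
rewrite -(size_rcons c s); apply: chain_max_increasing.
rewrite chain_rcons sP sa sb ltnSn /=.
case/lastP: c hc => [|c t] //; rewrite !chain_rcons => /and4P[tP ta tb ->].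
rewrite tP tb andbT /=; case: (ltngtP t.1 s.1) => // [st|/val_inj st].
  by case: hN; exists s, t; split=> //; apply/andP.
by move: tb; rewrite (colP tP sP st) sb ltnn.
Qed.

(** A chain ending at the marker [s] of row [b] can end at [t] instead: if the marker [u] before [s]
    were above [t], then [u], [s], [t] would form a 231. *)
Lemma max_increasing_row_tail a b : avoids231 a b.+1 -> row_tail a b ->
  max_increasing P (a, b.+1) = max_increasing P (a, b).
Proof.
move=> hav /row_tailP[s [t [sP tP sb /andP[st ta] tb]]].
apply/eqP; rewrite eqn_leq (max_increasing_leq (leqnn a) (leqnSn b)) andbT.
have [c + <-] := max_increasing_chain a b.+1.
case/lastP: c => [|c s'] // hc; move: (hc); rewrite chain_rcons size_rcons.
case/and4P=> s'P s'a s'b hc'.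
have [s'b'|s'b'|s'b'] := ltngtP s'.2 b; [|by slia|].
  rewrite -(size_rcons c s'); apply: chain_max_increasing.
  by rewrite chain_rcons s'P s'a s'b'.
have es : s' = s by apply: rowP => //; apply: val_inj; rewrite /= sb.
rewrite {s' s'P s'a s'b s'b' hc}es in hc'.
rewrite -(size_rcons c t); apply: chain_max_increasing.
rewrite chain_rcons tP ta tb /=.
case/lastP: c hc' => [|c u] //; rewrite !chain_rcons => /and4P[uP us ub ->].
rewrite uP andbT /= (ltn_trans us st) /=.
case: (ltngtP u.2 t.2) => // [ut|/val_inj ut]; last first.
  by move: st; rewrite -(rowP uP tP ut); slia.
by case: (hav u s t) => //; rewrite ?us ?st ?ut ?ub //; slia.
Qed.

(** * Runs, and their change when one column is added *)

Definition incr_head k (r : seq nat) := if r is x :: r' then (k + x) :: r' else [::].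

Fixpoint runs a b : seq nat :=
  if b is b'.+1 then
    if has_row a b' then
      if row_tail a b' then incr_head 1 (runs a b') else 1 :: runs a b'
    else runs a b'
  else [::].

Lemma size_incr_head k r : size (incr_head k r) = size r.
Proof. by case: r. Qed.

(** A run opens exactly where the longest chain grows. *)
Lemma size_runs a b : avoids231 a b -> size (runs a b) = max_increasing P (a, b).
Proof.
elim: b => [|b IH] hav /=; first by rewrite max_increasing0.
have {}IH := IH (avoids231_leq (leqnn a) (leqnSn b) hav).
case: ifP => hr; last by rewrite max_increasing_empty_row ?hr.
case: ifP => ht; first by rewrite size_incr_head max_increasing_row_tail.
by rewrite max_increasing_row_last ?ht //= IH.
Qed.

(** The number called [j] in the opening comment, when [y] is the row of the marker of column
    [a]. *)
Definition occupied a y b := \sum_(y.+1 <= z < b) has_row a z.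

Section ColumnStep.
Variable s : square m.
Hypothesis sP : s \in P.
Local Notation a := (s.1 : nat).
Local Notation y := (s.2 : nat).

Lemma has_row_col z : z != y -> has_row a.+1 z = has_row a z.
Proof.
move=> zy; apply/has_rowP/has_rowP=> -[t [tP ta tz]]; exists t; split=> //.
  case: (ltngtP t.1 a) => // [|/val_inj e]; first by slia.
  by move: zy; rewrite -tz (colP tP sP e) eqxx.
by slia.
Qed.

(** The new marker [s] is not below row [z], so it cannot turn that row into a tail. *)
Lemma row_tail_col z : z <= y -> row_tail a.+1 z = row_tail a z.
Proof.
move=> zy; apply/row_tailP/row_tailP=> -[u [t [uP tP uz ut tz]]].
all: exists u, t; split=> //; case/andP: ut => -> ta //=.
  2: by slia.
case: (ltngtP t.1 a) => // [|/val_inj e]; first by slia.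
by move: zy; rewrite leqNgt -(colP tP sP e) tz.
Qed.

Lemma runs_col z : z <= y -> runs a.+1 z = runs a z.
Proof.
elim: z => [|z IH] //= zy; rewrite IH; last by slia.
by rewrite has_row_col ?row_tail_col //; slia.
Qed.

Lemma occupiedS z : y < z -> occupied a y z.+1 = occupied a y z + has_row a z.
Proof. by move=> yz; rewrite /occupied big_nat_recr. Qed.

(** Within the first [a.+1] columns [s] is the rightmost marker, so row [y] opens a run. Every
    marker in a higher row has [s] below and to its right, so its row joins that run. *)
Lemma runs_after z : y < z -> runs a.+1 z = (occupied a y z).+1 :: runs a y.
Proof.
elim: z => [|z IH] //; rewrite ltnS leq_eqVlt => /predU1P[<-{IH}|yz].
  rewrite /= /occupied big_geq // runs_col //.
  have -> : has_row a.+1 y by apply/has_rowP; exists s.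
  case: ifP => // /row_tailP[u [t [uP tP uy ut _]]].
  have e : u = s by apply: rowP => //; apply: val_inj.
  by move: ut; rewrite e; slia.
rewrite /= has_row_col ?IH ?occupiedS //; last by slia.
case: ifP => hr; last by rewrite addn0.
rewrite ifT /= ?addn1 ?add1n //; apply/row_tailP.
have /has_rowP[t [tP ta tz]] := hr.
by exists t, s; rewrite tz ta ltnSn yz.
Qed.

Variable b : nat.
Hypotheses (sb : s.2 < b) (hav : avoids231 s.1.+1 b).

(** The markers of R(a, b) above [s] descend from left to right, since two rising ones followed by
    [s] would form a 231. Hence only the lowest of them can open a run, and the rows of the others
    join the same run. *)
Lemma runs_before z : y < z -> z <= b ->
  runs a z = incr_head (occupied a y z) (runs a y) \/
  0 < occupied a y z /\ runs a z = occupied a y z :: runs a y.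
Proof.
elim: z => [|z IH] //; rewrite ltnS leq_eqVlt => /predU1P[<-{IH}|yz] zb.
  rewrite /= /occupied big_geq // ifF; last first.
    apply/has_rowP => -[u [uP ua uy]]; move: ua.
    by rewrite (rowP uP sP) ?ltnn //; apply: val_inj.
  by left; case: (runs a y).
have {IH} := IH yz (ltnW zb); rewrite /= occupiedS //.
case: ifP => hr IH; last by rewrite addn0.
(* If no row between [y] and [z] is occupied, row [z] is the lowest one, and both outcomes are
   possible. *)
rewrite addn1; have [o0|opos] := posnP (occupied a y z).
  have -> : runs a z = runs a y.
    by case: IH => [->|[]]; rewrite o0 //; case: (runs a y).
  by rewrite o0; case: ifP => _; [left|right].
have ht : row_tail a z.
  have /hasP[x hx hxr] : has (has_row a) (index_iota y.+1 z).
    by move: opos; rewrite /occupied -big_mkcond sum1_count -has_count.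
  move: hx; rewrite mem_index_iota => /andP[yx xz].
  have /has_rowP[t [tP ta tx]] := hxr; have /has_rowP[u [uP ua uz]] := hr.
  apply/row_tailP; exists u, t; split=> //; last by rewrite tx.
  rewrite ta andbT; case: (ltngtP u.1 t.1) => // [tu|/val_inj e].
    by case: (hav tP uP sP); rewrite ?tu ?ua ?ltnSn ?uz ?tx //; slia.
  by move: xz; rewrite -tx -uz (colP uP tP e) ltnn.
rewrite ht; case: IH => [->|[_ ->]]; last by right.
by left; case: (runs a y) => //= x r; rewrite addnA.
Qed.

(** The two alternatives of [runs_before] differ in length. Only the second has one run more than
    [runs a y], as [runs a.+1 b] does, and these lengths are the values of [max_increasing]. *)
Lemma runs_pred :
  runs a b = if max_increasing P (a, b) == max_increasing P (a.+1, b)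
             then occupied a y b :: runs a y
             else incr_head (occupied a y b) (runs a y).
Proof.
have hav' := avoids231_leq (leqnSn a) (leqnn b) hav.
rewrite -!size_runs // runs_after //=.
have [-> | [_ ->]] := runs_before sb (leqnn b); last by rewrite eqxx.
by rewrite size_incr_head ifF //; slia.
Qed.
End ColumnStep.
End Chains.

(** * Ferrers boards and a local description of the border *)

Section Board.
Variables (m : nat) (F : {set square m}).
Hypothesis hF : ferrers F.
Implicit Types (s t : square m) (a b i j : nat).

Definition filled i j := [exists s in F, (s.1 == i :> nat) && (s.2 == j :> nat)].

Lemma filledP i j :
  reflect (exists s, [/\ s \in F, s.1 = i :> nat & s.2 = j :> nat]) (filled i j).
Proof.
apply: (iffP exists_inP) => [[s sF /andP[/eqP si /eqP sj]]|[s [sF si sj]]].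
  by exists s.
by exists s; rewrite ?si ?sj ?eqxx.
Qed.

Lemma filled_square s : s \in F -> filled s.1 s.2.
Proof. by move=> sF; apply/filledP; exists s. Qed.

Lemma filled_ltn i j : filled i j -> (i < m) && (j < m).
Proof. by case/filledP=> s [_ <- <-]; rewrite !ltn_ord. Qed.

Lemma filled_leq i j i' j' : i' <= i -> j' <= j -> filled i j -> filled i' j'.
Proof.
move=> hi hj hij; have /andP[im jm] := filled_ltn hij.
have /filledP[s [sF si sj]] := hij.
have im' := leq_ltn_trans hi im; have jm' := leq_ltn_trans hj jm.
apply/filledP; exists (Ordinal im', Ordinal jm'); split=> //.
have /subsetP : rect m (i.+1, j.+1) \subset F.
  apply: hF; apply/existsP; exists s.
  by rewrite sF /corner /= si sj !eqxx !orbT.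
by apply; rewrite inE /= !ltnS hi.
Qed.

(** The square to the upper right of the vertex is outside [F] and the one to its lower left is
    inside. On the axes, where the latter does not exist, the middle conditions keep the vertex
    within the width and height of [F]. *)
Definition on_border a b :=
  [&& ~~ filled a b, (a == 0) || filled a.-1 0, (b == 0) || filled 0 b.-1
    & [|| a == 0, b == 0 | filled a.-1 b.-1]].

Lemma on_border_leq a b : on_border a b -> a <= m.
Proof. by case: a => [|a] // /and4P[_ /filled_ltn]; slia. Qed.

Lemma on_border_right a b :
  on_border a b.+1 -> filled a b -> on_border a.+1 b.+1.
Proof.
case/and4P=> h1 _ /= h3 _ h.
rewrite /on_border /= h h3 (filled_leq (leqnn a) (leq0n b) h) !andbT.
by apply: contra h1; apply: filled_leq.
Qed.

Lemma on_border_down a b :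
  on_border a b.+1 -> ~~ filled a b -> on_border a b.
Proof.
case/and4P=> h1 h2 /= h3 h4 h; rewrite /on_border h h2 /=.
case: b h1 h3 h4 h => [|b] // h1 h3 /= h4 h; rewrite ?orbT //.
rewrite (filled_leq (leqnn 0) (leqnSn b) h3) /=.
case: a h1 h2 h4 h => [|a] //= _ _ h _.
by apply: filled_leq h.
Qed.

(** The two ends of the right step of the border above the column of [s]; [b] is one more than the
    highest filled row of that column. *)
Lemma column_top s : s \in F ->
  exists b, [/\ s.2 < b, on_border s.1 b & on_border s.1.+1 b].
Proof.
move=> /filled_square fs.
have ub b : filled s.1 b -> b <= m by move=> /filled_ltn; slia.
case: (ex_maxnP (ex_intro _ (s.2 : nat) fs) ub) => b fb bmax.
have nb : ~~ filled s.1 b.+1 by apply/negP => /bmax; slia.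
have hb : on_border s.1 b.+1.
  rewrite /on_border nb /= (filled_leq (leq0n _) _ fb) //=.
  case: (s.1 : nat) fb => [|i] //= fb.
  by rewrite (filled_leq (leqnSn i) (leq0n b) fb) (filled_leq (leqnSn i) _ fb).
exists b.+1; split=> //; first by rewrite ltnS; apply: bmax.
exact: on_border_right.
Qed.

(** * Runs along the border for a full placement *)

Section Placement.
Variable P : {set square m}.
Hypothesis fP : full_rook_placement F P.

Lemma full_col_inj : {in P &, injective (fun s => s.1)}.
Proof.
case: fP => -[_ hc _] _ _ s t sP tP /= e.
have /card_le1_eqP := hc s.1; apply; rewrite inE ?sP ?tP ?e /=; exact/eqP.
Qed.

Lemma full_row_inj : {in P &, injective (fun s => s.2)}.
Proof.
case: fP => -[_ _ hc] _ _ s t sP tP /= e.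
have /card_le1_eqP := hc s.2; apply; rewrite inE ?sP ?tP ?e /=; exact/eqP.
Qed.

Lemma full_filled s : s \in P -> filled s.1 s.2.
Proof.
by case: fP => -[/subsetP hP _ _] _ _ sP; apply: filled_square; apply: hP.
Qed.

Lemma full_col i j : filled i j -> exists2 s, s \in P & s.1 = i :> nat.
Proof.
case/filledP=> s [sF <- _]; case: fP => _ /(_ s.1) hc _.
have /eqP /cards1P [t /setP /(_ t)] : #|col P s.1| = 1.
  by apply: hc; apply/set0Pn; exists s; rewrite inE sF eqxx.
by rewrite !inE eqxx => /andP[tP /eqP e]; exists t; rewrite // e.
Qed.

Lemma full_row i j : filled i j -> exists2 s, s \in P & s.2 = j :> nat.
Proof.
case/filledP=> s [sF _ <-]; case: fP => _ _ /(_ s.2) hc.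
have /eqP /cards1P [t /setP /(_ t)] : #|row P s.2| = 1.
  by apply: hc; apply/set0Pn; exists s; rewrite inE sF eqxx.
by rewrite !inE eqxx => /andP[tP /eqP e]; exists t; rewrite // e.
Qed.

Hypothesis avP : forall a b, on_border a b -> avoids231 P a b.

(** Row [b] of [F] is nonempty and ends before column [a], so its marker lies in R(a, b+1); the
    border values tell whether the row joins the first run. *)
Lemma runs_down a b : on_border a b.+1 -> ~~ filled a b ->
  runs P a b.+1 = if max_increasing P (a, b.+1) == max_increasing P (a, b)
                  then incr_head 1 (runs P a b) else 1 :: runs P a b.
Proof.
move=> hb nab; have /and4P[_ _ /full_row[s sP sb] _] := hb.
have hr : has_row P a b.
  apply/has_rowP; exists s; split=> //; rewrite ltnNge; apply: contra nab => sa.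
  by apply: filled_leq (full_filled sP); rewrite // sb.
rewrite /= hr; case: ifP => ht.
  by rewrite (max_increasing_row_tail full_row_inj (avP hb) ht) eqxx.
rewrite (max_increasing_row_last full_col_inj hr) ?ht // ifF //.
by apply/eqP; slia.
Qed.

(** By [runs_after] the list [r] is nonempty with head [j + 1], so [j] is read off from [r] and the
    unknown row of the marker does not appear. *)
Lemma runs_right a b : on_border a b.+1 -> filled a b ->
  let r := runs P a.+1 b.+1 in
  runs P a b.+1 =
    if max_increasing P (a, b.+1) == max_increasing P (a.+1, b.+1)
    then (head 0 r).-1 :: behead r else incr_head (head 0 r).-1 (behead r).
Proof.
move=> hb fab r; have [s sP sa] := full_col fab.
have sb : s.2 < b.+1.
  rewrite ltnNge; have /and4P[+ _ _ _] := hb; apply: contra => bs.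
  by apply: filled_leq (full_filled sP); rewrite // sa.
have hav : avoids231 P s.1.+1 b.+1.
  by apply: avP; rewrite sa; apply: on_border_right.
have := runs_pred full_col_inj full_row_inj sP sb hav.
have := runs_after full_col_inj full_row_inj sP sb.
by rewrite /r sa => ->.
Qed.
End Placement.

(** * Reconstruction of a 231-avoider from its border values *)

Section Uniqueness.
Variables P Q : {set square m}.
Hypothesis fP : full_rook_placement F P.
Hypothesis fQ : full_rook_placement F Q.
Hypothesis avP : forall a b, on_border a b -> avoids231 P a b.
Hypothesis avQ : forall a b, on_border a b -> avoids231 Q a b.
Hypothesis hPQ : forall a b, on_border a b ->
  max_increasing P (a, b) = max_increasing Q (a, b).

Lemma runs_eq a b : on_border a b -> runs P a b = runs Q a b.
Proof.
(* The measure decreases at each step of the border, and at [b = 0] both lists are empty. *)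
have [n] := ubnP ((m - a) + b); elim: n a b => [|n IH] a [|b] // hn hb.
have am := on_border_leq hb.
have [fab|nab] := boolP (filled a b).
  have hb' := on_border_right hb fab.
  have am' := on_border_leq hb'.
  rewrite (runs_right fP avP hb fab) (runs_right fQ avQ hb fab).
  by rewrite !hPQ // IH //; slia.
have hb' := on_border_down hb nab.
rewrite (runs_down fP avP hb nab) (runs_down fQ avQ hb nab).
by rewrite !hPQ // IH //; slia.
Qed.

End Uniqueness.

(** If [t] were higher than [s], then [P] would have more markers above [s] than [Q] has above [t]
    in the columns to the left, while equal runs make these numbers equal. *)
Lemma full_unique_leq P Q s t :
  full_rook_placement F P -> full_rook_placement F Q ->
  (forall a b, on_border a b -> avoids231 P a b) ->
  (forall a b, on_border a b -> avoids231 Q a b) ->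
  (forall a b, on_border a b -> max_increasing P (a, b) = max_increasing Q (a, b)) ->
  (forall u : square m, s.1 < u.1 -> (u \in P) = (u \in Q)) ->
  s \in P -> t \in Q -> s.1 = t.1 :> nat -> t.2 <= s.2.
Proof.
move=> fP fQ avP avQ hPQ IH sP tQ st; rewrite leqNgt; apply/negP => lst.
have tF : t \in F by case: fQ => -[/subsetP hQ _ _] _ _; apply: hQ.
have [b [tb hb hb']] := column_top tF.
have := runs_eq fP fQ avP avQ hPQ hb'.
rewrite (runs_after (full_col_inj fQ) (full_row_inj fQ) tQ tb) -st.
rewrite (runs_after (full_col_inj fP) (full_row_inj fP) sP (ltn_trans lst tb)).
case=> eo _; suff : occupied Q s.1 t.2 b < occupied P s.1 s.2 b by rewrite eo ltnn.
(* The marker of [P] in row [z] is not right of column [s.1], where it would also be the marker of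
   [Q], and not in that column, whose marker [s] is lower. *)
have row z : s.2 < z -> has_row Q s.1 z || (z == t.2 :> nat) -> has_row P s.1 z.
  move=> sz hz; have [u uQ uz] : exists2 u, u \in Q & u.2 = z :> nat.
    by case/orP: hz => [/has_rowP[u [? _ ?]]|/eqP->]; [exists u | exists t].
  have us : u.1 <= s.1.
    case/orP: hz => [/has_rowP[v [vQ vs vz]]|/eqP zt].
      have -> : u = v by apply: (full_row_inj fQ) => //; apply: val_inj; rewrite /= uz.
      exact: ltnW.
    have -> : u = t by apply: (full_row_inj fQ) => //; apply: val_inj; rewrite /= uz.
    by rewrite st.
  have [v vP vz] := full_row fP (full_filled fQ uQ).
  apply/has_rowP; exists v; split; rewrite ?vz //.
  case: (ltngtP v.1 s.1) => // [sv|/val_inj e].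
    have vQ : v \in Q by rewrite -IH.
    have e : v = u by apply: (full_row_inj fQ) => //; apply: val_inj.
    by move: us; rewrite -e leqNgt sv.
  by move: sz; rewrite -uz -vz (full_col_inj fP vP sP e) ltnn.
(* The sum for [P] is split after row [t.2], whose own term is 1 and makes the inequality strict. *)
rewrite /occupied (@big_cat_nat _ _ _ t.2.+1 s.2.+1) //=; [|slia].
rewrite big_nat_recr //= row ?eqxx ?orbT // -addnA addnCA add1n ltnS.
apply: leq_trans (leq_addl _ _).
rewrite big_nat_cond [X in _ <= X]big_nat_cond.
apply: leq_sum => z /andP[/andP[tz zb] _].
case: (boolP (has_row Q s.1 z)) => // hz; rewrite row ?hz //.
exact: ltn_trans tz.
Qed.

(** Columns are compared from right to left, with [full_unique_leq] used in both directions. *)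
Lemma full_unique231 P Q :
  full_rook_placement F P -> full_rook_placement F Q ->
  (forall a b, on_border a b -> avoids231 P a b) ->
  (forall a b, on_border a b -> avoids231 Q a b) ->
  (forall a b, on_border a b -> max_increasing P (a, b) = max_increasing Q (a, b)) ->
  P = Q.
Proof.
move=> fP fQ avP avQ hPQ; apply/setP => s.
have [n] := ubnP (m - s.1); elim: n s => [|n IH] // s hn.
have {}IH (u : square m) : s.1 < u.1 -> (u \in P) = (u \in Q).
  by move=> su; apply: IH; have := ltn_ord u.1; slia.
have hQP a b : on_border a b -> max_increasing Q (a, b) = max_increasing P (a, b).
  by move=> hb; rewrite hPQ.
have IH' (u : square m) : s.1 < u.1 -> (u \in Q) = (u \in P) by move=> su; rewrite IH.
have PQs t u : t \in P -> u \in Q -> t.1 = s.1 -> u.1 = s.1 -> t = u.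
  move=> tP uQ ts us; have tu : t.1 = u.1 by rewrite us.
  suff : t.2 = u.2 by case: t u tu {tP uQ ts us} => [? ?] [? ?] /= -> ->.
  apply/val_inj/eqP; rewrite eqn_leq; apply/andP; split.
    by apply: (full_unique_leq fQ fP avQ avP hQP _ uQ tP); rewrite ?us ?ts.
  by apply: (full_unique_leq fP fQ avP avQ hPQ _ tP uQ); rewrite ?us ?ts.
apply/idP/idP => sPQ.
  have [t tQ /val_inj ts] := full_col fQ (full_filled fP sPQ).
  by rewrite (PQs s t).
have [t tP /val_inj ts] := full_col fP (full_filled fQ sPQ).
by rewrite -(PQs t s).
Qed.
End Board.

(** Such a list is a rearrangement of an initial segment of the naturals. This turns the sizes of
    rows and columns into membership of squares. *)
Lemma downset_size (l : seq nat) i : uniq l ->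
  (forall x y, x <= y -> y \in l -> x \in l) -> (i < size l) = (i \in l).
Proof.
move=> ul hl; apply/idP/idP => [|il].
  apply: contraTT => il; rewrite -leqNgt -(size_iota 0 i).
  apply: uniq_leq_size => // x xl; rewrite mem_iota /= ltnNge.
  by apply: contra il => ix; apply: hl xl.
rewrite -(size_iota 0 i.+1); apply: uniq_leq_size; first exact: iota_uniq.
by move=> x; rewrite mem_iota /= ltnS => xi; apply: hl il.
Qed.

(** * The border path reaches every border vertex *)

Section Border.
Variables (m : nat) (F : {set square m}).
Hypothesis hF : ferrers F.

Lemma ltn_card_row i (j : 'I_m) : (i < #|row F j|) = filled F i j.
Proof.
pose l := [seq nat_of_ord s.1 | s <- enum (row F j)].
have meml k : (k \in l) = filled F k j.
  apply/mapP/filledP => [[s]|[s [sF <- sj]]].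
    by rewrite mem_enum inE => /andP[sF /eqP <-] ->; exists s.
  by exists s; rewrite // mem_enum inE sF; apply/eqP/val_inj.
rewrite cardE -(size_map (fun s : square m => nat_of_ord s.1)) -/l -meml.
apply: downset_size => [|x y xy]; last by rewrite !meml; apply: filled_leq.
rewrite map_inj_in_uniq ?enum_uniq // => -[s1 s2] [t1 t2].
by rewrite !mem_enum !inE => /andP[_ /eqP/= ->] /andP[_ /eqP/= ->] /val_inj ->.
Qed.

Lemma ltn_card_col (i : 'I_m) j : (j < #|col F i|) = filled F i j.
Proof.
pose l := [seq nat_of_ord s.2 | s <- enum (col F i)].
have meml k : (k \in l) = filled F i k.
  apply/mapP/filledP => [[s]|[s [sF si <-]]].
    by rewrite mem_enum inE => /andP[sF /eqP <-] ->; exists s.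
  by exists s; rewrite // mem_enum inE sF; apply/eqP/val_inj.
rewrite cardE -(size_map (fun s : square m => nat_of_ord s.2)) -/l -meml.
apply: downset_size => [|x y xy]; last by rewrite !meml; apply: filled_leq.
rewrite map_inj_in_uniq ?enum_uniq // => -[s1 s2] [t1 t2].
by rewrite !mem_enum !inE => /andP[_ /eqP/= ->] /andP[_ /eqP/= ->] /val_inj ->.
Qed.

Lemma ltn_width i : (i < width F) = filled F i 0.
Proof.
apply/idP/idP => [|fi].
  apply: contraTT => fi; rewrite -leqNgt; apply/bigmax_leqP => j _.
  by rewrite leqNgt ltn_card_row //; apply: contra fi; apply: filled_leq.
have m0 : 0 < m by case/andP: (filled_ltn fi).
by apply: (@bigmax_sup _ (Ordinal m0)) => //; rewrite ltn_card_row.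
Qed.

Lemma ltn_height j : (j < height F) = filled F 0 j.
Proof.
apply/idP/idP => [|fj].
  apply: contraTT => fj; rewrite -leqNgt; apply/bigmax_leqP => i _.
  by rewrite leqNgt ltn_card_col //; apply: contra fj; apply: filled_leq.
have m0 : 0 < m by case/andP: (filled_ltn fj).
by apply: (@bigmax_sup _ (Ordinal m0)) => //; rewrite ltn_card_col.
Qed.

Lemma border_stepE a b : border_step F (a, b) =
  if (0 < b) && filled F a b.-1 then (a.+1, b) else (a, b.-1).
Proof.
rewrite /border_step /filled /=; case: b => [|b] /=.
  by rewrite ifF //; apply/exists_inP => -[s _]; rewrite andbF.
by [].
Qed.

Lemma on_border_bounds a b : on_border F a b -> a <= width F /\ b <= height F.
Proof.
case/and4P=> _ ha hb _; split.
  by case: a ha => [|a] //=; rewrite -ltn_width.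
by case: b hb => [|b] //=; rewrite -ltn_height.
Qed.

Lemma on_border_iter k : k <= width F + height F ->
  let V := iter k (border_step F) (0, height F) in
  on_border F V.1 V.2 /\ V.1 + height F = k + V.2.
Proof.
elim: k => [|k IH] kn /=.
  rewrite /on_border -!ltn_height ltnn /=.
  by case: (height F) => [|h] //=; rewrite ltnSn.
have [] := IH (ltnW kn).
case: (iter _ _ _) => a b /= hb e; rewrite border_stepE.
case: b hb e => [|b] hb e /=.
  (* At height 0 the path is already at its end, so all its steps have been made, against the bound
     on [k]. *)
  have /and4P[] := hb; rewrite -ltn_width.
  by have [] := on_border_bounds hb; slia.
case: ifP => [fab|/negbT nab] /=; split; try slia.
  exact: on_border_right.
exact: on_border_down.
Qed.

(** A line of slope 1 meets the border once: a vertex further up the line has a filled square to its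
    lower left, which forces the square to the upper right of the other vertex to be filled. *)
Lemma on_border_antidiag a b a' b' : on_border F a b -> on_border F a' b' ->
  a + b' = a' + b -> a <= a'.
Proof.
move=> h h' e; rewrite leqNgt; apply/negP => lt.
have /and4P[nf _ _ _] := h'; have /and4P[_ _ _] := h.
case/or3P => [/eqP a0|/eqP b0|f]; [lia|lia|].
by case/negP: nf; apply: (filled_leq hF _ _ f); slia.
Qed.

Lemma mem_border a b : on_border F a b -> (a, b) \in border F.
Proof.
move=> hb; have [aw bh] := on_border_bounds hb.
(* Each step raises the difference of the coordinates by 1, starting from [- height F], so this step
   reaches the line of slope 1 through [(a, b)]. *)
have kn : a + height F - b <= width F + height F by slia.
apply/trajectP; exists (a + height F - b) => //.
have [] := on_border_iter kn; case: (iter _ _ _) => a' b' /= hb' e.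
have a1 := on_border_antidiag hb hb'; have a2 := on_border_antidiag hb' hb.
by congr (_, _); slia.
Qed.
End Border.

(** * Pattern occurrences as configurations of markers *)

Section Patterns.
Variable m : nat.
Implicit Types (s t : square m) (c : seq (square m)) (P A : {set square m}).

(** The order in which [heights] reads the squares. *)
Definition lex s t := (s.1 < t.1) || (s.1 == t.1) && (s.2 < t.2).

Lemma lex_trans : transitive lex.
Proof.
move=> t s u /orP[st|/andP[/eqP st st2]] /orP[tu|/andP[/eqP tu tu2]].
- by rewrite /lex (ltn_trans st tu).
- by rewrite /lex -tu st.
- by rewrite /lex st tu.
- by rewrite /lex st tu eqxx (ltn_trans st2 tu2) orbT.
Qed.

Lemma lex_irr : irreflexive lex.
Proof. by move=> s; rewrite /lex !ltnn andbF. Qed.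

Lemma pairwise_enum_ord : pairwise (fun i j : 'I_m => i < j) (enum 'I_m).
Proof.
rewrite -(pairwise_map val ltn) val_enum_ord -sorted_pairwise ?iota_ltn_sorted //.
exact: ltn_trans.
Qed.

Lemma pairwise_squares :
  pairwise lex [seq (i, j) | i <- enum 'I_m, j <- enum 'I_m].
Proof.
have := pairwise_enum_ord; elim: {1 3}(enum 'I_m) => [|i l IH] //= /andP[hi hl].
rewrite pairwise_cat IH // andbT; apply/andP; split.
  apply/allrelP => s t /mapP[j _ ->] /allpairsP[[i' j'] /= [il _ ->]].
  by rewrite /lex /= (allP hi i' il).
rewrite pairwise_map; apply: sub_pairwise pairwise_enum_ord => j j' jj /=.
by rewrite /lex eqxx jj orbT.
Qed.

(** The list [c] and the enumeration of squares filtered by membership in [c] are both [lex]-sorted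
    with the same elements, hence equal. *)
Lemma subseq_heights A c : all (mem A) c ->
  sorted (fun s t => s.1 < t.1) c ->
  subseq [seq nat_of_ord s.2 | s <- c] (heights A).
Proof.
move=> cA hc; apply: map_subseq; set L := [seq s <- _ | _].
have hL : pairwise lex L by apply: pairwise_filter; apply: pairwise_squares.
suff -> : c = [seq s <- L | s \in c] by apply: filter_subseq.
apply: (irr_sorted_eq lex_trans lex_irr).
- by apply: sub_sorted hc => s t st; rewrite /lex st.
- by rewrite (sorted_pairwise lex_trans); apply: pairwise_filter.
move=> [i j]; rewrite !mem_filter; have [ijc|] //= := boolP ((i, j) \in c).
have ijA : (i, j) \in A := allP cA _ ijc.
by rewrite ijA allpairs_f ?mem_enum.
Qed.

Lemma ltn_count_leq (w : seq nat) x y : y \in w ->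
  x < y -> count (fun z => z <= x) w < count (fun z => z <= y) w.
Proof.
move=> yw xy.
have -> : count (fun z => z <= y) w =
          count (fun z => z <= x) w + count (fun z => x < z <= y) w.
  by elim: w {yw} => [|z w IH] //=; slia.
rewrite -[X in X < _]addn0 ltn_add2l -has_count.
by apply/hasP; exists y; rewrite ?xy /=.
Qed.

Lemma ltn_standardize (w : seq nat) x y : x \in w -> y \in w ->
  (count (fun z => z <= x) w < count (fun z => z <= y) w) = (x < y).
Proof.
move=> xw yw; case: (ltngtP x y) => [xy|yx|->]; last exact: ltnn.
  exact: ltn_count_leq.
by apply/negbTE; rewrite -leqNgt ltnW // ltn_count_leq.
Qed.

(** Standardizing preserves all comparisons between letters of the word, so an occurrence among the
    markers becomes one in the permutation. *)
Lemma avoids_squares P tau a b c :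
  avoids (standardize (heights (P :&: rect m (a, b)))) tau ->
  all (mem (P :&: rect m (a, b))) c -> sorted (fun s t => s.1 < t.1) c ->
  ~ order_isomorphic [seq nat_of_ord s.2 | s <- c] tau.
Proof.
move=> hav cA hc [hsize hiso]; apply: hav.
set w := heights _; have sub : subseq _ w := subseq_heights cA hc.
have sub' := map_subseq (fun x => count (fun y => y <= x) w) sub.
eexists; first exact: sub'.
rewrite /order_isomorphic size_map; split=> // i j hi hj.
rewrite -hiso // !(nth_map 0) // ltn_standardize //.
all: by apply: (mem_subseq sub); rewrite mem_nth.
Qed.

Lemma avoids231_squares P a b :
  avoids (standardize (heights (P :&: rect m (a, b)))) [:: 2; 3; 1] ->
  avoids231 P a b.
Proof.
move=> hav s t u sP tP uP /andP[st tu] /andP[us st'] ua tb.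
apply: (@avoids_squares P _ a b [:: s; t; u] hav).
- by rewrite /= !inE sP tP uP /=; slia.
- by rewrite /= st tu.
by split=> // -[|[|[|i]]] // [|[|[|j]]] // _ _ /=; slia.
Qed.

(** * Reflection in the diagonal *)

Definition swap s : square m := (s.2, s.1).

Lemma swapK : involutive swap. Proof. by case. Qed.

Definition transpose A : {set square m} := swap @^-1: A.

Lemma in_transpose A s : (s \in transpose A) = (swap s \in A).
Proof. by rewrite inE. Qed.

Lemma transposeK : involutive transpose.
Proof. by move=> A; apply/setP => s; rewrite !in_transpose swapK. Qed.

Lemma card_transpose A : #|transpose A| = #|A|.
Proof. exact/card_preimset/(can_inj swapK). Qed.

Lemma col_transpose A i : col (transpose A) i = transpose (row A i).
Proof. by apply/setP => s; rewrite !inE. Qed.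

Lemma row_transpose A i : row (transpose A) i = transpose (col A i).
Proof. by apply/setP => s; rewrite !inE. Qed.

Lemma transpose_eq0 A : (transpose A == set0) = (A == set0).
Proof. by rewrite -!cards_eq0 card_transpose. Qed.

Lemma ferrers_transpose A : ferrers A -> ferrers (transpose A).
Proof.
move=> hA [a b] /existsP[s /andP[sA hs]]; apply/subsetP => t ht.
have /subsetP : rect m (b, a) \subset A.
  apply: hA; apply/existsP; exists (swap s); rewrite -in_transpose sA.
  by move: hs; rewrite /corner /= andbC.
by rewrite in_transpose; apply; move: ht; rewrite !inE /= andbC.
Qed.

Lemma full_rook_placement_transpose A P :
  full_rook_placement A P -> full_rook_placement (transpose A) (transpose P).
Proof.
case=> -[sub hc hr] fc fr; split; first split.
- exact: preimsetS.
- by move=> i; rewrite col_transpose card_transpose.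
- by move=> i; rewrite row_transpose card_transpose.
- by move=> i; rewrite !col_transpose card_transpose transpose_eq0; apply: fr.
- by move=> i; rewrite !row_transpose card_transpose transpose_eq0; apply: fc.
Qed.

Lemma filled_transpose A i j : filled (transpose A) i j = filled A j i.
Proof.
apply/filledP/filledP => -[s [sA <- <-]]; exists (swap s); split=> //.
  by rewrite -in_transpose.
by rewrite in_transpose swapK.
Qed.

Lemma on_border_transpose A a b : on_border (transpose A) a b = on_border A b a.
Proof.
rewrite /on_border !filled_transpose; congr (_ && _); rewrite andbCA.
by congr [&& _, _ & _]; rewrite orbCA.
Qed.

Lemma max_increasing_transpose P a b :
  max_increasing (transpose P) (a, b) = max_increasing P (b, a).
Proof.
have le Q i j : max_increasing (transpose Q) (i, j) <= max_increasing Q (j, i).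
  have [c /andP[cQ hc] <-] := max_increasing_chain (transpose Q) i j.
  rewrite -(size_map swap); apply: chain_max_increasing; apply/andP; split.
    rewrite all_map; apply: sub_all cQ => s /=; rewrite !inE /=.
    by rewrite andbA andbAC -andbA.
  by rewrite sorted_map; apply: sub_sorted hc => s t; rewrite /above_right andbC.
by apply/eqP; rewrite eqn_leq le -{1}(transposeK P) le.
Qed.

(** The inverse of 231 is 312: an occurrence [s], [t], [u] read by increasing height is [u], [s],
    [t], with columns in the order 3, 1, 2. *)
Lemma avoids231_transpose P a b :
  avoids (standardize (heights (P :&: rect m (b, a)))) [:: 3; 1; 2] ->
  avoids231 (transpose P) a b.
Proof.
move=> hav s t u; rewrite !in_transpose => sP tP uP /andP[st tu] /andP[us st'] ua tb.
apply: (@avoids_squares P _ b a [:: swap u; swap s; swap t] hav).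
- by rewrite /= !inE sP tP uP /=; slia.
- by rewrite /= us st'.
by split=> // -[|[|[|i]]] // [|[|[|j]]] // _ _ /=; slia.
Qed.
End Patterns.

Theorem theorem1 (m : nat) (F : {set square m}) (hF : ferrers F)
    (tau : seq nat) (htau : tau \in [:: [:: 2; 3; 1]; [:: 3; 1; 2]])
    (P Q : {set square m})
    (hP : full_avoider F tau P) (hQ : full_avoider F tau Q)
    (hPQ : border_values P F = border_values Q F) :
  P = Q.
Proof.
case: hP hQ => fP avP [fQ avQ].
have {}hPQ a b : on_border F a b ->
    max_increasing P (a, b) = max_increasing Q (a, b).
  by move=> /(mem_border hF); move: (a, b); apply/eq_in_map.
move: htau avP avQ; rewrite !inE => /orP[]/eqP-> avP avQ.
  apply: (full_unique231 hF fP fQ _ _ hPQ) => a b hb.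
    exact/avoids231_squares/avP/mem_border.
  exact/avoids231_squares/avQ/mem_border.
(* For 312, the reflected placements avoid 231 on the reflected board. *)
rewrite -[P]transposeK -[Q]transposeK; congr transpose.
apply: (full_unique231 (ferrers_transpose hF)).
- exact: full_rook_placement_transpose.
- exact: full_rook_placement_transpose.
- move=> a b; rewrite on_border_transpose => hb.
  exact/avoids231_transpose/avP/mem_border.
- move=> a b; rewrite on_border_transpose => hb.
  exact/avoids231_transpose/avQ/mem_border.
move=> a b; rewrite on_border_transpose => hb.
by rewrite !max_increasing_transpose hPQ.
Qed.
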